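(* Let $N\ge1$, $p=2N+1$, $b\in\mathbb{T}=\mathbb{R}/(2\pi\mathbb{Z})$ be fixed, and let $v=(v_k)_1^p\in\mathbb{R}^p$, $v\to0$. Let $\lambda_0(t)=\lambda_0(t,b,v)$ be the middle eigenvalue of the Jacobi matrix $J_t(b,v)$ defined in the context. Then $$\lambda_0(t)=\sum_{k=0}^N v_{2k+1}\,\eta_k(t)+O(\|v\|^2),$$ $$\eta_k(t)=\frac{\beta_k^2(t)}{\sum_{s=0}^N\beta_s^2(t)},\qquad \beta_0=1,\qquad \beta_k=\prod_{j=1}^{2k}a_j(t),\quad 1\le k\le N,$$ uniformly in $t\in[0,2\pi]$.
   Context: For $t\in[0,2\pi]$, $b\in\mathbb{T}$, $v\in\mathbb{R}^p$, $J_t(b,v)$ is the symmetric $p\times p$ Jacobi matrix with diagonal $v_1,\dots,v_p$ and off-diagonal entries $(J_t)_{n,n+1}=(J_t)_{n+1,n}=a_n(t)$, $1\le n\le p-1$, where $a_n(t)=1$ for $n$ even and $a_n(t)=2|\cos(\frac t2-\frac{3n-2}{2}b)|$ for $n$ odd. Its eigenvalues are ordered as $\lambda_{-N}(t,b,v)\le\lambda_{-N+1}(t,b,v)\le\dots\le\lambda_N(t,b,v)$. $\|\cdot\|$ is the Euclidean norm on $\mathbb{R}^p$. *)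

(* Defs.v *)
From HB Require Import structures.
From mathcomp Require Import all_boot all_order all_algebra.
From mathcomp Require Import all_classical all_reals all_analysis.
From mathcomp Require Import complex polyrcf.
From mathcomp Require Import ring.

Set Implicit Arguments.
Unset Strict Implicit.
Unset Printing Implicit Defensive.

Import Order.TTheory GRing.Theory Num.Theory.

Local Open Scope ring_scope.

Section Eigenvalues.
Variable R : rcfType.

(* Eigenvalues in nondecreasing order, repeated according to their
   multiplicity; for a symmetric matrix all n of them are real, see
   eigenvalues_prod and size_eigenvalues. *)
Definition eigenvalues n (A : 'M[R]_n) : seq R :=
  sort <=%R (flatten [seq nseq (mup x (char_poly A)) x
                     | x <- rootsR (char_poly A)]).

Lemma eigenvalues_sorted n (A : 'M[R]_n) : sorted <=%R (eigenvalues A).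
Proof. exact/sort_sorted/le_total. Qed.

Lemma perm_eigenvalues n (A : 'M[R]_n) (s : seq R) :
  char_poly A = \prod_(x <- s) ('X - x%:P) -> perm_eq (eigenvalues A) s.
Proof.
move=> As; rewrite /eigenvalues perm_sort.
have p0 : char_poly A != 0 by rewrite monic_neq0 ?char_poly_monic.
have rsE x : (x \in rootsR (char_poly A)) = (x \in s).
  by rewrite -(roots_on_rootsR p0) in_itv /= As root_prod_XsubC.
have ur : uniq (rootsR (char_poly A)).
  by apply/lt_sorted_uniq/sorted_roots.
apply/permP => P; rewrite count_flatten -map_comp.
have -> : count P s = sumn [seq (P x * count_mem x s)%N
                           | x <- rootsR (char_poly A)].
  rewrite sumnE big_map.
  rewrite (perm_big (undup s)) /=; last first.
    apply: uniq_perm => //; first exact: undup_uniq.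
    by move=> x; rewrite rsE mem_undup.
  rewrite -sum1_count big_mkcond -big_undup_iterop_count /=.
  by apply: eq_bigr => x _; rewrite Monoid.iteropE iter_addn_0; case: (P x).
by congr sumn; apply: eq_map => x /=; rewrite count_nseq As mu_prod_XsubC.
Qed.

Lemma char_poly_sym_split n (A : 'M[R]_n) : A^T = A ->
  exists s : seq R, char_poly A = \prod_(x <- s) ('X - x%:P).
Proof.
move=> AT; pose B : 'M[R[i]]_n := map_mx (real_complex R) A.
have Bre : B \is a realmx.
  by apply/mxOverP => i j; rewrite mxE complex_real.
have Bsym : B \is symmetricmx.
  by apply/is_hermitianmxP; rewrite expr0 scale1r map_mx_id // map_trmx AT.
have Bh := realsym_hermsym Bsym Bre.
have dre := hermitian_spectral_diag_real Bh.
have /orthomx_spectralP BE := hermitian_normalmx Bh.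
exists [seq complex.Re (spectral_diag B 0 i) | i <- enum 'I_n].
apply: (@map_poly_inj _ _ (real_complex R)).
rewrite map_char_poly -/B big_map rmorph_prod /= big_enum /=.
have P_unit := spectral_unit B.
have -> : char_poly B = char_poly (diag_mx (spectral_diag B)).
  rewrite [in LHS]BE /char_poly /char_poly_mx.
  set P := spectralmx B; set D := diag_mx _.
  have PP : map_mx polyC (invmx P) *m map_mx polyC P = 1%:M.
    by rewrite -map_mxM mulVmx // map_mx1.
  have -> : 'X%:M - map_mx polyC (invmx P *m D *m P) =
      map_mx polyC (invmx P) *m ('X%:M - map_mx polyC D) *m map_mx polyC P.
    by rewrite mulmxBr mulmxBl scalar_mxC -!mulmxA PP mulmx1 !map_mxM -?mulmxA.
  by rewrite !det_mulmx mulrAC -det_mulmx PP det1 mul1r.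
rewrite char_poly_trig ?diag_mx_is_trig //; apply: eq_bigr => i _.
rewrite mxE eqxx mulr1n map_polyXsubC /=.
by have /mxOverP /(_ 0 i) /complex_realP [k ->] := dre.
Qed.

Lemma eigenvalues_prod n (A : 'M[R]_n) : A^T = A ->
  char_poly A = \prod_(x <- eigenvalues A) ('X - x%:P).
Proof.
move=> /char_poly_sym_split [s As].
by rewrite As; apply/esym/perm_big/perm_eigenvalues.
Qed.

Lemma size_eigenvalues n (A : 'M[R]_n) : A^T = A -> size (eigenvalues A) = n.
Proof.
move=> /eigenvalues_prod /(congr1 (fun p : {poly R} => size p)).
by rewrite size_char_poly size_prod_XsubC => -[].
Qed.

End Eigenvalues.

Section JacobiMatrix.
Variable R : realType.

(* b is a real representative of a class in R / 2 pi Z; by hop_period the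
   value depends on the class only. *)
Definition hop (b : R) (n : nat) (t : R) : R :=
  if odd n then 2 * `|cos (t / 2 - (3 * n%:R - 2) / 2 * b)| else 1.

Lemma hop_period (b t : R) (n : nat) : hop (b + 2 * pi) n t = hop b n t.
Proof.
have H (m : nat) (x : R) : `|cos (x + m%:R * pi)| = `|cos x|.
  elim: m => [|m IH]; first by rewrite mul0r addr0.
  by rewrite -natr1 mulrDl mul1r addrA cosDpi normrN.
rewrite /hop; case: ifP => // on; congr (2 * _).
have n0 : (0 < n)%N by case: n on.
rewrite -(H (3 * n - 2)%N).
congr (`|cos _|); rewrite natrB ?natrM; last by rewrite (@leq_trans 3) // leq_pmulr.
by field.
Qed.

(* Ordinals start at 0: entry (i, j) is the 1-based entry (i + 1, j + 1). *)
Definition jacobi (p : nat) (t b : R) (v : 'rV[R]_p) : 'M[R]_p :=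
  \matrix_(i, j)
    if i == j then v 0 i
    else if j == i.+1 :> nat then hop b i.+1 t
    else if i == j.+1 :> nat then hop b j.+1 t
    else 0.

Lemma jacobi_sym (p : nat) (t b : R) (v : 'rV[R]_p) :
  (jacobi t b v)^T = jacobi t b v.
Proof.
apply/matrixP => i j; rewrite !mxE eq_sym; case: eqP => [-> //|_].
case: (eqVneq (i : nat) j.+1) => [->|//].
by rewrite -[X in X == _]addn0 -addn2 eqn_add2l.
Qed.

(* The eigenvalue number j, -N <= j <= N, of the matrix of size 2N+1; junk
   for the other values of j. *)
Definition lambda (N : nat) (j : int) (t b : R) (v : 'rV[R]_N.*2.+1) : R :=
  (eigenvalues (jacobi t b v))`_(absz (N%:Z + j)).

(* The 1-based coordinate v_n, 1 <= n <= 2N+1. *)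
Definition coord1 (N : nat) (v : 'rV[R]_N.*2.+1) (n : nat) : R :=
  v 0 (inord n.-1).

Definition beta_coef (b : R) (k : nat) (t : R) : R :=
  \prod_(1 <= j < k.*2.+1) hop b j t.

Definition eta_coef (N : nat) (b : R) (k : nat) (t : R) : R :=
  beta_coef b k t ^+ 2 / \sum_(0 <= s < N.+1) beta_coef b s t ^+ 2.

(* The library norm on row vectors is the sup norm. *)
Definition enorm (p : nat) (v : 'rV[R]_p) : R :=
  Num.sqrt (\sum_(i < p) v 0 i ^+ 2).

End JacobiMatrix.

(* Main.v *)
(** The unperturbed matrix exchanges the even and the odd sites, and its kernel
is spanned by the vector psi with entries (-1)^k beta_k at the sites 2k+1.  For
sg = 1 (resp. -1) the vectors s psi + (- sg B y, y), where B is the block that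
maps the even sites to the odd ones, form a space of dimension N+1 on which the
unperturbed form is - 2 sg |B y|^2.  Every other hopping equals 1, so B is
bounded below uniformly in t.  Hence on this space the perturbed form is, up to
the factor |x|^2, at most (resp. at least) the first-order term plus (resp.
minus) O(|v|^2), and the min-max principle bounds the middle eigenvalue. *)

Require Import Defs.
From HB Require Import structures.
From mathcomp Require Import all_boot all_order all_algebra.
From mathcomp Require Import all_classical all_reals all_analysis.
From mathcomp Require Import complex.
From mathcomp Require Import ring lra.

Set Implicit Arguments.
Unset Strict Implicit.
Unset Printing Implicit Defensive.

Import Order.TTheory GRing.Theory Num.Theory.

Local Open Scope ring_scope.

(** * Min-max bounds for the ordered eigenvalues of a real symmetric matrix *)

Section MinMax.
Variable R : rcfType.
Local Notation C := R[i].
Local Open Scope sesquilinear_scope.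

Lemma Re_mul_conj (q : R) (x y : C) :
  complex.Re (x * q%:C%C * y^*) =
  q * (complex.Re x * complex.Re y + complex.Im x * complex.Im y).
Proof. by case: x y => [a b] [c e] /=; ring. Qed.

(** The diagonalization is unitary over [R[i]]; this splitting lets an inequality on real vectors be
    used on complex ones. *)
Lemma Re_complex_form k (Q : 'M[R]_k) (u : 'rV[C]_k) :
  complex.Re ((u *m map_mx (real_complex R) Q *m u^t*) 0 0) =
  (map_mx (@complex.Re R) u *m Q *m (map_mx (@complex.Re R) u)^T) 0 0 +
  (map_mx (@complex.Im R) u *m Q *m (map_mx (@complex.Im R) u)^T) 0 0.
Proof.
rewrite !mxE raddf_sum -big_split; apply: eq_bigr => i _ /=.
rewrite !mxE !mulr_suml raddf_sum -big_split; apply: eq_bigr => j _ /=.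
rewrite !mxE Re_mul_conj; ring.
Qed.

(** If fewer than [k] entries of [d] were at most [mu], some nonzero combination of the rows of [W]
    would have no component along their eigenvectors. The form of [A - mu] is positive there,
    against the hypothesis. *)
Lemma card_spectrum_le n k (A : 'M[R]_n) (P : 'M[C]_n) (d : 'rV[R]_n)
    (W : 'M[R]_(k, n)) (mu : R) :
  P \is unitarymx ->
  map_mx (real_complex R) A =
    P^t* *m diag_mx (map_mx (real_complex R) d) *m P ->
  row_free W ->
  (forall u : 'rV[R]_k,
     (u *m W *m A *m (u *m W)^T) 0 0 <= mu * (u *m W *m (u *m W)^T) 0 0) ->
  (k <= #|[pred i | (d 0 i <= mu)%R]|)%N.
Proof.
move=> Pu AE Wf Wle; set I := [pred i | _]; rewrite leqNgt; apply/negP => ltIk.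
pose Wc := map_mx (real_complex R) W.
pose G : 'M[C]_(k, n) := Wc *m P^t*.
pose M : 'M[C]_(k, #|I|) := \matrix_(j, l) G j (enum_val l).
have : kermx M != 0.
  by rewrite -mxrank_eq0 mxrank_ker -lt0n subn_gt0 (leq_ltn_trans (rank_leq_col _)).
case/rowV0Pn => u /sub_kermxP uM u0.
(* [c] holds the coordinates in the eigenbasis of the combination of rows given by [u]. *)
have [c cE] : exists c, c = u *m G by exists (u *m G).
have cI i : d 0 i <= mu -> c 0 i = 0.
  move=> di; have iI : i \in I by [].
  have <- : (u *m M) 0 (enum_rank_in iI i) = c 0 i.
    rewrite cE [LHS]mxE [RHS]mxE; apply: eq_bigr => j _.
    by rewrite [M _ _]mxE enum_rankK_in.
  by rewrite uM mxE.
pose Q := W *m (A - mu%:M) *m W^T.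
have trC m1 m2 m3 (X : 'M[C]_(m1, m2)) (Y : 'M[C]_(m2, m3)) :
    (X *m Y)^t* = Y^t* *m X^t* by rewrite trmx_mul map_mxM.
have WcT : map_mx (real_complex R) W^T = Wc^t*.
  apply/matrixP => i j; rewrite !mxE.
  by apply/esym/CrealP; rewrite complex_real.
have QE : u *m map_mx (real_complex R) Q *m u^t* =
          c *m map_mx (real_complex R) (diag_mx d - mu%:M) *m c^t*.
  have PP : P *m P^t* = 1%:M by apply/unitarymxP.
  have PV : P^t* *m P = 1%:M by apply: mulmx1C.
  have AmuE : map_mx (real_complex R) (A - mu%:M) =
      P^t* *m map_mx (real_complex R) (diag_mx d - mu%:M) *m P.
    rewrite !map_mxB /= AE map_diag_mx map_scalar_mx /= mulmxBr mulmxBl.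
    by rewrite scalar_mxC -mulmxA -mulmxA PV mulmx1.
  by rewrite cE /G /Q !trC trmxCK !map_mxM /= WcT AmuE !mulmxA.
have Qle (w : 'rV[R]_k) : (w *m Q *m w^T) 0 0 <= 0.
  suff -> : (w *m Q *m w^T) 0 0 = (w *m W *m A *m (w *m W)^T) 0 0 -
      mu * (w *m W *m (w *m W)^T) 0 0 by rewrite subr_le0.
  have -> : w *m Q *m w^T = w *m W *m (A - mu%:M) *m (w *m W)^T.
    by rewrite /Q trmx_mul !mulmxA.
  by rewrite mulmxBr mulmxBl scalar_mxC mul_scalar_mx -scalemxAl !mxE.
have dE (x : 'rV[R]_n) : (x *m (diag_mx d - mu%:M) *m x^T) 0 0 =
    \sum_i (d 0 i - mu) * x 0 i ^+ 2.
  rewrite mulmxBr mul_mx_diag scalar_mxC mul_scalar_mx !mxE.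
  by apply: eq_bigr => i _; rewrite !mxE; ring.
have /(congr1 (fun X : 'M[C]_1 => complex.Re (X 0 0))) := QE.
rewrite !Re_complex_form !dE -big_split /= => sE.
have cge i : 0 <= (d 0 i - mu) * map_mx (@complex.Re R) c 0 i ^+ 2 +
                  (d 0 i - mu) * map_mx (@complex.Im R) c 0 i ^+ 2.
  rewrite !mxE; have [/cI ->|/ltW le] := leP (d 0 i) mu.
    by rewrite /= expr0n !mulr0 addr0.
  by rewrite addr_ge0 // mulr_ge0 ?sqr_ge0 ?subr_ge0.
(* The sum is nonpositive by [Qle] at the real and imaginary parts of [u], and nonnegative by
   [cge]. *)
have s0 : \sum_i ((d 0 i - mu) * map_mx (@complex.Re R) c 0 i ^+ 2 +
                  (d 0 i - mu) * map_mx (@complex.Im R) c 0 i ^+ 2) = 0.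
  apply/eqP; rewrite eq_le sumr_ge0 // andbT -sE.
  by rewrite -[leRHS]addr0 lerD.
have c0 : c = 0.
  apply/rowP => i; rewrite [RHS]mxE; have [/cI //|lt] := leP (d 0 i) mu.
  have /(_ i isT) := psumr_eq0P (fun j _ => cge j) s0; rewrite -mulrDr !mxE.
  move/eqP; rewrite mulf_eq0 gt_eqF ?subr_gt0 //= paddr_eq0 ?sqr_ge0 //.
  rewrite !sqrf_eq0 => /andP[/eqP r0 /eqP i0].
  by apply/eqP; rewrite eq_complex /= r0 i0 !eqxx.
case/negP: u0; apply/eqP.
have Gf : row_free G.
  rewrite /row_free mxrankMfree ?mxrank_map //.
  by rewrite row_free_unit; apply: unitarymx_unit; rewrite trmxC_unitary.
by apply: (row_free_inj Gf); rewrite -cE c0 mul0mx.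
Qed.

Lemma card_spectrum_ge n k (A : 'M[R]_n) (P : 'M[C]_n) (d : 'rV[R]_n)
    (W : 'M[R]_(k, n)) (mu : R) :
  P \is unitarymx ->
  map_mx (real_complex R) A =
    P^t* *m diag_mx (map_mx (real_complex R) d) *m P ->
  row_free W ->
  (forall u : 'rV[R]_k,
     mu * (u *m W *m (u *m W)^T) 0 0 <= (u *m W *m A *m (u *m W)^T) 0 0) ->
  (k <= #|[pred i | (mu <= d 0 i)%R]|)%N.
Proof.
move=> Pu AE Wf Wge.
rewrite (@eq_card _ _ [pred i | ((- d) 0 i <= - mu)%R]); last first.
  by move=> i; rewrite !inE mxE lerN2.
apply: (card_spectrum_le (A := - A) Pu _ Wf) => [|u].
  by rewrite map_mxN AE (map_mxN (real_complex R)) linearN mulmxN mulNmx.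
by rewrite mulmxN !mulNmx mulNr [leLHS]mxE lerN2.
Qed.

Lemma char_poly_conjV (F : comNzRingType) n (P Q D : 'M[F]_n) :
  P *m Q = 1%:M -> char_poly (Q *m D *m P) = char_poly D.
Proof.
move=> PQ; rewrite /char_poly /char_poly_mx.
have QP : map_mx polyC Q *m map_mx polyC P = 1%:M.
  by rewrite -map_mxM (mulmx1C PQ) map_mx1.
have -> : 'X%:M - map_mx polyC (Q *m D *m P) =
    map_mx polyC Q *m ('X%:M - map_mx polyC D) *m map_mx polyC P.
  by rewrite mulmxBr mulmxBl scalar_mxC -(mulmxA 'X%:M) QP mulmx1 !map_mxM.
by rewrite !det_mulmx mulrAC -det_mulmx QP det1 mul1r.
Qed.

(** The complexified matrix is Hermitian, so its spectral diagonal is real; comparing characteristic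
    polynomials identifies it with [eigenvalues A] up to order. *)
Lemma eigenvalues_diag n (A : 'M[R]_n) : A^T = A ->
  exists (P : 'M[C]_n) (d : 'rV[R]_n), [/\ P \is unitarymx,
    map_mx (real_complex R) A =
      P^t* *m diag_mx (map_mx (real_complex R) d) *m P &
    perm_eq (eigenvalues A) [seq d 0 i | i <- enum 'I_n]].
Proof.
move=> AT; pose B := map_mx (real_complex R) A; pose P := spectralmx B.
have Pu : P \is unitarymx by apply: spectral_unitarymx.
have Bre : B \is a realmx by apply/mxOverP => i j; rewrite mxE complex_real.
have Bh : B \is hermsymmx.
  apply: realsym_hermsym => //; apply/is_hermitianmxP.
  by rewrite expr0 scale1r map_mx_id // map_trmx AT.
have dre := hermitian_spectral_diag_real Bh.
pose d := map_mx (@complex.Re R) (spectral_diag B).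
have dE : map_mx (real_complex R) d = spectral_diag B.
  apply/rowP => i; rewrite !mxE.
  by have /mxOverP /(_ 0 i) /complex_realP [x ->] := dre.
have BE : B = P^t* *m diag_mx (map_mx (real_complex R) d) *m P.
  by rewrite dE -invmx_unitary //; apply/orthomx_spectralP/hermitian_normalmx.
exists P, d; split => //; apply: perm_eigenvalues.
apply: (@map_poly_inj _ _ (real_complex R)).
rewrite map_char_poly -/B BE.
rewrite char_poly_conjV; last exact/unitarymxP.
rewrite char_poly_trig ?diag_mx_is_trig // big_map rmorph_prod /= big_enum /=.
by apply: eq_bigr => i _; rewrite !mxE eqxx mulr1n map_polyXsubC.
Qed.

(** In a sorted list the entries at most [mu] form a prefix. *)
Lemma nth_sorted_le (s : seq R) (mu : R) k :
  sorted <=%R s -> (k < count (fun x => x <= mu)%R s)%N -> s`_k <= mu.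
Proof.
elim: s k => [|x s IHs] [|k] //= xs.
  case: leP => //= mux; rewrite -has_count => /hasP[y ys ymu].
  have /allP /(_ y ys) xy := order_path_min le_trans xs.
  by have := lt_le_trans mux (le_trans xy ymu); rewrite ltxx.
rewrite -ltnS => lt; apply: IHs; first exact: path_sorted xs.
by move: lt; case: (x <= mu)%R => //= /ltnW.
Qed.

(** The entries at least [mu] form a suffix, hence the index counted from the end. *)
Lemma nth_sorted_ge (s : seq R) (mu : R) k :
  sorted <=%R s -> (k < count (fun x => mu <= x)%R s)%N ->
  mu <= s`_(size s - k.+1).
Proof.
elim: s k => [|x s IHs] k //= xs; rewrite subSS.
have xmin := order_path_min le_trans xs.
case: leP => [mux _|_ /=]; last first.
  rewrite add0n => lt; have ks : (k < size s)%N by apply: leq_trans lt (count_size _ _).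
  by rewrite -(subnSK ks) /= IHs // (path_sorted xs).
case: (size s - k)%N (leq_subr k (size s)) => [|j] //= js.
by rewrite (le_trans mux) // (allP xmin) // mem_nth.
Qed.

Lemma nth_eigenvalues_le n k (A : 'M[R]_n) (W : 'M[R]_(k.+1, n)) (mu : R) :
  A^T = A -> row_free W ->
  (forall u : 'rV[R]_k.+1,
     (u *m W *m A *m (u *m W)^T) 0 0 <= mu * (u *m W *m (u *m W)^T) 0 0) ->
  (eigenvalues A)`_k <= mu.
Proof.
move=> AT Wf Wle; have [P [d [Pu AE peq]]] := eigenvalues_diag AT.
have lt := card_spectrum_le Pu AE Wf Wle.
apply: nth_sorted_le; first exact: eigenvalues_sorted.
by rewrite (permP peq) count_map enumT -size_filter -cardE.
Qed.

Lemma nth_eigenvalues_ge n k (A : 'M[R]_n) (W : 'M[R]_(k.+1, n)) (mu : R) :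
  A^T = A -> row_free W ->
  (forall u : 'rV[R]_k.+1,
     mu * (u *m W *m (u *m W)^T) 0 0 <= (u *m W *m A *m (u *m W)^T) 0 0) ->
  mu <= (eigenvalues A)`_(n - k.+1).
Proof.
move=> AT Wf Wge; have [P [d [Pu AE peq]]] := eigenvalues_diag AT.
have lt := card_spectrum_ge Pu AE Wf Wge.
rewrite -{2}(size_eigenvalues AT).
apply: nth_sorted_ge; first exact: eigenvalues_sorted.
by rewrite (permP peq) count_map enumT -size_filter -cardE.
Qed.

End MinMax.

(** * Sums split by parity, and the quadratic form of a Jacobi matrix *)

Section BigSums.
Variable R : pzRingType.

Lemma sum_even_odd (F : nat -> R) n :
  \sum_(i < n.*2.+1) F i =
  \sum_(k < n.+1) F k.*2 + \sum_(k < n) F k.*2.+1.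
Proof.
elim: n => [|n IHn]; first by rewrite big_ord1 big_ord1 big_ord0 addr0.
rewrite doubleS 2!big_ord_recr /= IHn [in RHS]big_ord_recr.
rewrite [\sum_(k < n.+1) F k.*2.+1]big_ord_recr /= doubleS -!addrA.
by congr (_ + _); rewrite [RHS]addrC addrA.
Qed.

Lemma sum_double (F : nat -> R) n :
  \sum_(i < n.*2) F i = \sum_(k < n) (F k.*2 + F k.*2.+1).
Proof.
elim: n => [|n IHn]; first by rewrite !big_ord0.
by rewrite doubleS 2!big_ord_recr /= IHn big_ord_recr /= addrA.
Qed.

End BigSums.

(** Induction on the size, peeling off the last row and column. The tests copy the entry of [jacobi]
    at row [j] and column [i]. *)
Lemma tridiag_form (R : comPzRingType) (v a x : nat -> R) n :
  \sum_(i < n.+1) (\sum_(j < n.+1)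
     x j * (if j == i :> nat then v j else if i == j.+1 :> nat then a j.+1
            else if j == i.+1 :> nat then a i.+1 else 0)) * x i =
  \sum_(i < n.+1) v i * x i ^+ 2 + 2 * \sum_(i < n) a i.+1 * (x i * x i.+1).
Proof.
elim: n => [|n IHn]; first by rewrite !big_ord_recl !big_ord0 /=; ring.
rewrite big_ord_recr /=; under eq_bigr do rewrite big_ord_recr /= mulrDl.
rewrite big_split /= IHn {IHn}.
rewrite [\sum_(i < n.+1) v i * _]big_ord_recr [in RHS]big_ord_recr.
rewrite [\sum_(i < n.+1) v i * _]big_ord_recr.
rewrite [\sum_(i < n.+1) a i.+1 * _]big_ord_recr /=.
(* [Q] is the inner sum at the last [i]; [T] gathers the terms with the last [j] and an earlier [i],
   of which only [i = n] survives. *)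
set Q := \sum_(j < n.+2) _; set T := \sum_(i < n.+1) _ * _ * _.
have -> : T = x n.+1 * a n.+1 * x n.
  rewrite /T big_ord_recr big1 /= ?add0r; last first.
    move=> i _; have lt := ltn_ord i.
    rewrite (gtn_eqF (leqW lt)) (ltn_eqF (leqW (leqW lt))).
    by rewrite eqSS gtn_eqF // mulr0 mul0r.
  by rewrite (gtn_eqF (ltnSn n)) (ltn_eqF (leqW (ltnSn n))) eqxx.
have -> : Q = x n * a n.+1 + x n.+1 * v n.+1.
  rewrite /Q 2!big_ord_recr big1 /= ?add0r; last first.
    move=> i _; have lt := ltn_ord i.
    rewrite (ltn_eqF (leqW lt)) eqSS (gtn_eqF lt).
    by rewrite (ltn_eqF (leqW (leqW lt))) mulr0.
  by rewrite ltn_eqF // !eqxx.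
ring.
Qed.

Lemma jacobi_form (R : realType) n (t b : R) (v : 'rV[R]_n.+1) (x : nat -> R) :
  ((\row_i x i) *m jacobi t b v *m (\row_i x i)^T) 0 0 =
  \sum_(i < n.+1) v 0 (inord i) * x i ^+ 2 +
  2 * \sum_(i < n) hop b i.+1 t * (x i * x i.+1).
Proof.
rewrite -(tridiag_form (fun i => v 0 (inord i)) (fun i => hop b i t)) mxE.
apply: eq_bigr => i _; rewrite !mxE; congr (_ * _); apply: eq_bigr => j _.
by rewrite !mxE inord_val.
Qed.

Lemma row_dot (R : realType) n (x : nat -> R) :
  ((\row_(i < n) x i) *m (\row_(i < n) x i)^T) 0 0 = \sum_(i < n) x i ^+ 2.
Proof. by rewrite mxE; apply: eq_bigr => i _; rewrite !mxE expr2. Qed.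

(** * Trial vectors, their norm and their form *)

Section TrialVectors.
Variables (R : realType) (c : nat -> R).
Implicit Types (y : nat -> R) (N k : nat).

(* The sites are counted from 0: [psi k] and [wimg y k] are entries at the site
   [k.*2], and [y k.+1] is the entry at the site [k.*2.+1].  The conventions
   [y 0 = y N.+1 = 0] spare a special case at both ends of the chain. *)
Definition psi k : R := \prod_(j < k) (- c j).

Definition wimg y k : R := y k + c k * y k.+1.

(** Counting from 0 swaps parities: the odd sites of the 1-based matrix are the even [i] here. *)
Definition trial (sg s : R) y (i : nat) : R :=
  if odd i then y i./2.+1 else s * psi i./2 - sg * wimg y i./2.

Lemma psiS k : psi k.+1 = - c k * psi k.
Proof. by rewrite /psi big_ord_recr mulrC. Qed.

Lemma trial_even sg s y k : trial sg s y k.*2 = s * psi k - sg * wimg y k.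
Proof. by rewrite /trial odd_double doubleK. Qed.

Lemma trial_odd sg s y k : trial sg s y k.*2.+1 = y k.+1.
Proof. by rewrite /trial /= odd_double /= uphalf_double. Qed.

Lemma sum_psi_sqr_gt0 N : 0 < \sum_(k < N.+1) psi k ^+ 2.
Proof.
rewrite big_ord_recl /= ltr_pwDl ?sumr_ge0 // => [|i _]; last exact: sqr_ge0.
by rewrite /psi big_ord0 expr1n.
Qed.

Section Boundary.
Variables (N : nat) (y : nat -> R).
Hypotheses (y0 : y 0 = 0) (yN : y N.+1 = 0).

(** The kernel vector is orthogonal to the image of the block: [c k * psi k = - psi k.+1] makes the
    sum telescope. *)
Lemma sum_psi_w : \sum_(k < N.+1) psi k * wimg y k = 0.
Proof.
rewrite (eq_bigr (fun k : 'I_N.+1 => - (psi k.+1 * y k.+1 - psi k * y k))).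
  2: by move=> k _; rewrite psiS /wimg; ring.
rewrite sumrN -(big_mkord xpredT (fun k => psi k.+1 * y k.+1 - psi k * y k)).
by rewrite telescope_sumr // yN y0 !mulr0 subr0 oppr0.
Qed.

(** Adjointness: [c k * wimg y k + wimg y k.+1] is the transposed block applied to [wimg y]. *)
Lemma sum_y_w :
  \sum_(k < N) y k.+1 * (c k * wimg y k + wimg y k.+1) =
  \sum_(k < N.+1) wimg y k ^+ 2.
Proof.
rewrite [RHS](eq_bigr (fun k : 'I_N.+1 => y k * wimg y k + c k * y k.+1 * wimg y k)).
  2: by move=> k _; rewrite /wimg; ring.
rewrite big_split /= big_ord_recl /= y0 mul0r add0r.
rewrite [X in _ = _ + X]big_ord_recr /= yN mulr0 mul0r addr0 -big_split.
by apply: eq_bigr => k _; rewrite /bump /=; ring.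
Qed.

Lemma trial_sqr_sum sg s : sg ^+ 2 = 1 ->
  \sum_(i < N.*2.+1) trial sg s y i ^+ 2 =
  s ^+ 2 * (\sum_(k < N.+1) psi k ^+ 2) +
  (\sum_(k < N.+1) wimg y k ^+ 2 + \sum_(k < N) y k.+1 ^+ 2).
Proof.
move=> sg2; rewrite (sum_even_odd (fun i => trial sg s y i ^+ 2)) addrA.
congr (_ + _); last by apply: eq_bigr => k _; rewrite trial_odd.
(* Subtracting the vanishing cross term lets the two sides agree term by term. *)
have -> : s ^+ 2 * (\sum_(k < N.+1) psi k ^+ 2) + \sum_(k < N.+1) wimg y k ^+ 2 =
    s ^+ 2 * (\sum_(k < N.+1) psi k ^+ 2) + \sum_(k < N.+1) wimg y k ^+ 2
    - 2 * s * sg * \sum_(k < N.+1) psi k * wimg y k by rewrite sum_psi_w; ring.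
rewrite !mulr_sumr -big_split -sumrB; apply: eq_bigr => k _ /=.
by rewrite trial_even; ring: sg2.
Qed.

(** This is half of the unperturbed form. By [psiS] the kernel vector drops out, and [sum_y_w]
    evaluates the rest. *)
Lemma trial_hop_sum (a : nat -> R) sg s :
  (forall k, a k.*2.+1 = c k) -> (forall k, a k.*2.+2 = 1) ->
  \sum_(i < N.*2) a i.+1 * (trial sg s y i * trial sg s y i.+1) =
  - sg * \sum_(k < N.+1) wimg y k ^+ 2.
Proof.
move=> ao ae; rewrite -sum_y_w mulr_sumr.
rewrite (sum_double (fun i => a i.+1 * (trial sg s y i * trial sg s y i.+1))).
apply: eq_bigr => k _; rewrite ao ae trial_even trial_odd -doubleS trial_even.
by rewrite psiS; ring.
Qed.

Hypothesis c2 : forall k, `|c k| <= 2.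

(** Solve [y k = wimg y k - c k * y k.+1] from the right end, where [y] vanishes. Each step costs a
    factor 10 = 2 + 2 * 4, from the square of a difference and [c k ^+ 2 <= 4]. *)
Lemma sqr_y_le j : (j <= N.+1)%N ->
  y (N.+1 - j)%N ^+ 2 <= 10 ^+ j * \sum_(k < N.+1) wimg y k ^+ 2.
Proof.
set S := \sum_(k < _) _; have S0 : 0 <= S by apply: sumr_ge0 => k _; exact: sqr_ge0.
elim: j => [|j IHj] jN; first by rewrite subn0 yN expr0n mul1r.
set k := (N.+1 - j.+1)%N; have kE : (N.+1 - j)%N = k.+1 by rewrite /k subnSK.
have wS : wimg y k ^+ 2 <= S.
  have kN : (k < N.+1)%N by rewrite /k subSS ltnS leq_subr.
  rewrite /S (bigD1 (Ordinal kN)) //= lerDl sumr_ge0 // => i _.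
  exact: sqr_ge0.
have := IHj (ltnW jN); rewrite kE => yk.
have yE : y k = wimg y k - c k * y k.+1 by rewrite /wimg; ring.
have ck : c k ^+ 2 <= 4.
  by have := c2 k; rewrite ler_norml => /andP[? ?]; nra.
have p1 : 1 <= 10 ^+ j :> R by rewrite exprn_ege1 // ler1n.
have cy : (c k * y k.+1) ^+ 2 <= 4 * y k.+1 ^+ 2.
  by rewrite exprMn ler_wpM2r ?sqr_ge0.
have sq : y k ^+ 2 <= 2 * wimg y k ^+ 2 + 2 * (c k * y k.+1) ^+ 2.
  by rewrite yE; have := sqr_ge0 (wimg y k + c k * y k.+1); nra.
have : S <= 10 ^+ j * S by rewrite ler_peMl.
by rewrite (exprS 10 j) -mulrA; lra.
Qed.

(** The constant depends on [N] alone, which yields the uniformity in [t]. *)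
Lemma sum_sqr_y_le :
  \sum_(k < N) y k.+1 ^+ 2 <=
  N%:R * 10 ^+ N.+1 * \sum_(k < N.+1) wimg y k ^+ 2.
Proof.
set S := \sum_(k < N.+1) _.
have S0 : 0 <= S by apply: sumr_ge0 => k _; exact: sqr_ge0.
have le (k : 'I_N) : y k.+1 ^+ 2 <= 10 ^+ N.+1 * S.
  have kN : (k.+1 <= N.+1)%N by rewrite ltnW // ltnS.
  have := sqr_y_le (leq_subr k.+1 N.+1); rewrite subKn // => /le_trans; apply.
  by rewrite ler_wpM2r // ler_weXn2l ?ler1n // leq_subr.
have /le_trans : \sum_(k < N) y k.+1 ^+ 2 <= \sum_(k < N) 10 ^+ N.+1 * S.
  by apply: ler_sum => k _; exact: le.
apply.
by rewrite sumr_const card_ord -[leLHS]mulr_natl mulrA.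
Qed.

(* [M] absorbs the cross terms between the kernel vector and its complement by
   AM-GM; what is left over is at most [2 / M] times the norm of the complement
   part, hence compensated by the unperturbed form. *)
Lemma trial_form_le (v : nat -> R) (e M sg s : R) :
  sg ^+ 2 = 1 -> M = 1 + N%:R * 10 ^+ N.+1 -> (forall i, `|v i| <= e) ->
  e * (2 * M) <= 1 ->
  \sum_(i < N.*2.+1) v i * trial sg s y i ^+ 2 -
    2 * \sum_(k < N.+1) wimg y k ^+ 2 <=
  ((\sum_(k < N.+1) v k.*2 * psi k ^+ 2) / (\sum_(k < N.+1) psi k ^+ 2)
     + M * e ^+ 2) * \sum_(i < N.*2.+1) trial sg s y i ^+ 2.
Proof.
move=> sg2 ME ve eM; rewrite trial_sqr_sum //.
have yS := sum_sqr_y_le.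
set P := \sum_(k < N.+1) psi k ^+ 2; set L := \sum_(k < N.+1) v _ * _.
set S := \sum_(k < N.+1) wimg y k ^+ 2 in yS *.
set Y := \sum_(k < N) y k.+1 ^+ 2 in yS *.
have P0 : 0 < P by apply: sum_psi_sqr_gt0.
have M1 : 1 <= M by rewrite ME lerDl mulr_ge0 // exprn_ge0.
have M0 : 0 < M by apply: lt_le_trans M1.
have e0 : 0 <= e by apply: le_trans (ve 0%N).
have Mi : M^-1 * M = 1 by rewrite mulVf ?gt_eqF.
have Mi0 : 0 < M^-1 by rewrite invr_gt0.
have S0 : 0 <= S by apply: sumr_ge0 => k _; exact: sqr_ge0.
have Y0 : 0 <= Y by apply: sumr_ge0 => k _; exact: sqr_ge0.
have vle i : - e <= v i <= e by rewrite -ler_norml.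
have v2 i : v i ^+ 2 <= e ^+ 2.
  by case/andP: (vle i) => ? ?; nra.
have vx : \sum_(i < N.*2.+1) v i * trial sg s y i ^+ 2 <=
    s ^+ 2 * L + M * e ^+ 2 * s ^+ 2 * P + (M^-1 + e) * (S + Y).
  rewrite (sum_even_odd (fun i => v i * trial sg s y i ^+ 2)) mulrDr addrA.
  apply: lerD.
    rewrite !mulr_sumr -!big_split; apply: ler_sum => k _ /=.
    rewrite trial_even; case/andP: (vle k.*2) => _ vk.
    (* This square bounds the cross term; the weight [M] leaves a kernel part quadratic in [e] and
       only [M^-1] on [wimg]. *)
    have sq : 0 <= M^-1 * (M * v k.*2 * s * psi k + sg * wimg y k) ^+ 2.
      by rewrite mulr_ge0 ?sqr_ge0 // ltW.
    have sqE : M^-1 * (M * v k.*2 * s * psi k + sg * wimg y k) ^+ 2 =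
      M * v k.*2 ^+ 2 * (s * psi k) ^+ 2 +
      2 * (v k.*2 * s * psi k * sg * wimg y k) + M^-1 * wimg y k ^+ 2.
      by ring: sg2 Mi.
    have le2 : M * v k.*2 ^+ 2 * (s * psi k) ^+ 2 <=
        M * e ^+ 2 * (s * psi k) ^+ 2.
      by rewrite ler_wpM2r ?sqr_ge0 // ler_wpM2l // ltW.
    have le3 : v k.*2 * wimg y k ^+ 2 <= e * wimg y k ^+ 2.
      by rewrite ler_wpM2r ?sqr_ge0.
    have -> : v k.*2 * (s * psi k - sg * wimg y k) ^+ 2 =
      s ^+ 2 * (v k.*2 * psi k ^+ 2) -
      2 * (v k.*2 * s * psi k * sg * wimg y k) + v k.*2 * wimg y k ^+ 2.
      by ring: sg2.
    by move: sq le2 le3; rewrite sqE !exprMn; lra.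
  rewrite mulr_sumr; apply: ler_sum => k _; rewrite trial_odd.
  rewrite ler_wpM2r ?sqr_ge0 //.
  by case/andP: (vle k.*2.+1) => _ vk; rewrite (le_trans vk) // lerDr ltW.
(* [L / P] is a weighted mean of the values of [v]. *)
have LP : - e <= L / P.
  rewrite ler_pdivlMr // mulr_sumr; apply: ler_sum => k _.
  by rewrite ler_wpM2r ?sqr_ge0 //; case/andP: (vle k.*2).
have LPE : L / P * (s ^+ 2 * P) = s ^+ 2 * L.
  by rewrite mulrCA divfK // gt_eqF.
have LPZ : - e * (S + Y) <= L / P * (S + Y) by rewrite ler_wpM2r // addr_ge0.
(* The choice of [M] gives [S + Y <= M * S], and [e * (2 * M) <= 1] gives [e + e <= M^-1]. *)
have ZS : (M^-1 + e + e) * (S + Y) <= 2 * S.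
  have Me : e + e <= M^-1 by rewrite -[leRHS]mul1r ler_pdivlMr // -mulr2n -mulr_natl -mulrA mulrCA.
  have ZM : M^-1 * (S + Y) <= S.
    by rewrite mulrC ler_pdivrMr // mulrC ME mulrDl mul1r lerD2l.
  have := ler_wpM2r (addr_ge0 S0 Y0) Me; lra.
have Z0 : 0 <= M * e ^+ 2 * (S + Y).
  by rewrite mulr_ge0 ?addr_ge0 // mulr_ge0 ?sqr_ge0 // ltW.
have -> : (L / P + M * e ^+ 2) * (s ^+ 2 * P + (S + Y)) =
    s ^+ 2 * L + L / P * (S + Y) + M * e ^+ 2 * s ^+ 2 * P
    + M * e ^+ 2 * (S + Y) by rewrite -LPE; ring.
by lra.
Qed.

End Boundary.
End TrialVectors.

(** * The space of trial vectors as the row space of a matrix of full rank *)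

Section TrialSpace.
Variables (R : realType) (N : nat) (c : nat -> R).

(** Coordinate 0 of [u] carries the factor [s] of [psi]; the zero values outside 1..[N] are the
    boundary conventions on [y]. *)
Definition ypart (u : 'rV[R]_N.+1) (k : nat) : R :=
  if (0 < k <= N)%N then u 0 (inord k) else 0.

Definition trial_row (sg : R) (u : 'rV[R]_N.+1) : 'rV[R]_N.*2.+1 :=
  \row_i trial c sg (u 0 0) (ypart u) i.

Lemma trial_row_is_linear sg : linear (trial_row sg).
Proof.
move=> a u1 u2; apply/rowP => i; rewrite !mxE.
have yE k : ypart (a *: u1 + u2) k = a * ypart u1 k + ypart u2 k.
  by rewrite /ypart; case: ifP => _; rewrite ?mxE // mulr0 addr0.
by rewrite /trial /wimg !yE; case: odd => //; ring.
Qed.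

HB.instance Definition _ sg :=
  GRing.isLinear.Build R 'rV[R]_N.+1 'rV[R]_N.*2.+1 *:%R (trial_row sg)
    (trial_row_is_linear sg).

Definition trial_mx sg : 'M[R]_(N.+1, N.*2.+1) := lin1_mx (trial_row sg).

Lemma mul_trial_mx sg u : u *m trial_mx sg = trial_row sg u.
Proof. exact: mul_rV_lin1. Qed.

(** The odd positions recover [y]; position 0 then recovers [s], since [psi] starts at 1. *)
Lemma trial_mx_free sg : row_free (trial_mx sg).
Proof.
apply: inj_row_free => u; rewrite mul_trial_mx => /rowP tu.
have tE i : (i < N.*2.+1)%N -> trial c sg (u 0 0) (ypart u) i = 0.
  by move=> iN; have := tu (Ordinal iN); rewrite !mxE.
have y0 k : ypart u k = 0.
  case kN : (0 < k <= N)%N; last by rewrite /ypart kN.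
  case: k kN => // k /= kN; have := tE k.*2.+1; rewrite trial_odd; apply.
  by rewrite ltnS ltn_double.
have s0 : u 0 0 = 0.
  have := tE 0%N isT; rewrite (trial_even _ _ _ _ 0) /wimg !y0 /psi big_ord0.
  by rewrite mulr0 addr0 mulr0 subr0 mulr1.
apply/rowP => k; rewrite mxE; have [->//|k0] := eqVneq k 0.
have := y0 k; rewrite /ypart inord_val lt0n k0 /=.
by rewrite -ltnS ltn_ord.
Qed.

End TrialSpace.

(** * Specialization to the given hoppings, and the first-order term *)

Section MiddleEigenvalue.
Variables (R : realType) (N : nat) (b : R).

Definition odd_hop (t : R) (k : nat) : R := hop b k.*2.+1 t.

Lemma hop_even t k : hop b k.*2.+2 t = 1.
Proof. by rewrite /hop /= odd_double. Qed.

Lemma odd_hop_le2 t k : `|odd_hop t k| <= 2.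
Proof.
rewrite /odd_hop /hop /= odd_double /= normrM normr_id ger0_norm //.
by rewrite -[leRHS]mulr1 ler_pM2l // cos_max.
Qed.

(** Even hoppings equal 1, and squaring removes the signs of [psi]. *)
Lemma beta_coef_sqr t k : beta_coef b k t ^+ 2 = psi (odd_hop t) k ^+ 2.
Proof.
elim: k => [|k IHk]; first by rewrite /beta_coef /psi big_geq ?big_ord0.
rewrite /beta_coef doubleS big_nat_recr // big_nat_recr //= -/(beta_coef b k t) hop_even mulr1.
by rewrite psiS !exprMn IHk sqrrN mulrC.
Qed.

Lemma normr_le_enorm p (v : 'rV[R]_p) i : `|v 0 i| <= enorm v.
Proof.
rewrite /enorm -sqrtr_sqr ler_wsqrtr // (bigD1 i) //= lerDl sumr_ge0 // => j _.
exact: sqr_ge0.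
Qed.

(** The first-order term is the Rayleigh quotient of the diagonal perturbation at [psi]. *)
Lemma sum_eta_coef (v : 'rV[R]_N.*2.+1) t :
  \sum_(0 <= k < N.+1) coord1 v k.*2.+1 * eta_coef N b k t =
  (\sum_(k < N.+1) v 0 (inord k.*2) * psi (odd_hop t) k ^+ 2) /
    \sum_(k < N.+1) psi (odd_hop t) k ^+ 2.
Proof.
rewrite mulr_suml big_mkord; apply: eq_bigr => k _.
rewrite /coord1 /eta_coef /= beta_coef_sqr mulrA big_mkord.
by congr (_ / _); apply: eq_bigr => j _; rewrite beta_coef_sqr.
Qed.

Lemma trial_row_jacobi_form t (v : 'rV[R]_N.*2.+1) sg u :
  let x := trial_row (odd_hop t) sg u in
  (x *m jacobi t b v *m x^T) 0 0 =
  \sum_(i < N.*2.+1) v 0 (inord i) *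
     trial (odd_hop t) sg (u 0 0) (ypart u) i ^+ 2
  - sg * (2 * \sum_(k < N.+1) wimg (odd_hop t) (ypart u) k ^+ 2).
Proof.
rewrite /= /trial_row jacobi_form.
rewrite (@trial_hop_sum _ (odd_hop t) _ (ypart u) _ _ (fun n => hop b n t)) //.
- by ring.
- by rewrite /ypart ltnn andbF.
- exact: hop_even.
Qed.

End MiddleEigenvalue.

Theorem theorem1p4 (R : realType) (N : nat) (hN : (1 <= N)%N) (b : R) :
  exists C delta : R, 0 < delta /\
    forall v : 'rV[R]_N.*2.+1, enorm v < delta ->
    forall t : R, 0 <= t <= 2 * pi ->
      `| lambda 0 t b v
         - \sum_(0 <= k < N.+1) coord1 v k.*2.+1 * eta_coef N b k t |
        <= C * enorm v ^+ 2.
Proof.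
pose M : R := 1 + N%:R * 10 ^+ N.+1.
have M0 : 0 < M by rewrite ltr_pwDl // mulr_ge0 // exprn_ge0.
(* [M] is the constant of [trial_form_le], and the radius is its smallness condition on [e]. *)
exists M, (2 * M)^-1; split; first by rewrite invr_gt0 mulr_gt0.
move=> v /ltW vM t _.
have eM : enorm v * (2 * M) <= 1 by rewrite -ler_pdivlMr ?mulr_gt0 // mul1r.
have c2 := odd_hop_le2 b t.
have yN (u : 'rV[R]_N.+1) : ypart u N.+1 = 0 by rewrite /ypart ltnn andbF.
rewrite sum_eta_coef /lambda addr0 absz_nat.
set P := \sum_(k < N.+1) psi _ _ ^+ 2; set L := \sum_(k < N.+1) _ * _.
have up : (eigenvalues (jacobi t b v))`_N <= L / P + M * enorm v ^+ 2.
  apply: (nth_eigenvalues_le (jacobi_sym t b v) (trial_mx_free N (odd_hop b t) 1)).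
  move=> u; rewrite mul_trial_mx trial_row_jacobi_form mul1r row_dot.
  apply: (trial_form_le _ (yN u) c2 (v := fun i => v 0 (inord i))) => //.
    by rewrite expr1n.
  by move=> i; apply: normr_le_enorm.
have low : L / P - M * enorm v ^+ 2 <= (eigenvalues (jacobi t b v))`_N.
  (* Index [N] is the middle from both ends, so dimension [N.+1] serves both bounds. *)
  have NE : (N.*2.+1 - N.+1)%N = N by rewrite subSS -addnn addnK.
  rewrite -[X in _`_X]NE.
  apply: (nth_eigenvalues_ge (jacobi_sym t b v) (trial_mx_free N (odd_hop b t) (-1))).
  move=> u; rewrite mul_trial_mx trial_row_jacobi_form mulN1r opprK row_dot.
  (* For [sg = -1] the unperturbed form is positive; negating everything reduces to the upper bound
     for [- v]. *)
  have vN i : `|- v 0 (inord i)| <= enorm v by rewrite normrN normr_le_enorm.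
  have sg2 : (-1) ^+ 2 = 1 :> R by rewrite sqrrN expr1n.
  have := trial_form_le (erefl _) (yN u) c2 (u 0 0) sg2 (erefl M) vN eM.
  under eq_bigr do rewrite mulNr.
  under [\sum_(k < N.+1) - _ * _]eq_bigr do rewrite mulNr.
  rewrite !sumrN -/L -/P mulNr; move: (L / P) => q; nra.
by rewrite ler_distl; apply/andP.
Qed.
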